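(* Let $G$ be a directed cactus graph, let $\{C_i\}_{i=1}^k$ be the unique set of cycle subgraphs of $G$, and let $\delta\ge 0$ be a real number. Then, for every dimension $n$, $$\tilde H_n(\mathfrak{D}_\delta(G))\cong\bigoplus_{i=1}^k\tilde H_n(\mathfrak{D}_\delta(C_i)).$$
   Context: A network (weighted directed graph) $G=(X,\omega)$ is a finite vertex set $X$ with $\omega:X\times X\to[0,\infty]$; pairs $x\ne y$ with $\omega(x,y)<\infty$ are its directed edges. The weight of a path $(x_0,\dots,x_m)$ is $\sum_i\omega(x_i,x_{i+1})$ ($0$ for a constant path), and $d(x,y)$ is the infimum of the weights of paths from $x$ to $y$. $\mathfrak{D}_\delta(G)$ is the simplicial complex on $X$ whose simplices are the nonempty $\sigma\subseteq X$ for which there is $y\in X$ with $d(y,x)\le\delta$ for all $x\in\sigma$. A directed cactus graph is a weighted directed graph obtained by orienting (and weighting) the edges of a cactus graph, i.e. of a connected undirected graph in which any two distinct cycles share at most one vertex; such a graph can be described as a sequence of wedge sums (unions identifying one distinguished vertex from each piece) of single directed edges and cycle graphs with arbitrary edge orientations. The cycle subgraphs $C_i$ are the subgraphs of $G$ whose underlying undirected graphs are cycles, with the weights and orientations inherited from $G$; $\mathfrak{D}_\delta(C_i)$ is computed from shortest paths within $C_i$. $\tilde H$ denotes reduced homology with real coefficients.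
   Formalization: For n = 0 it is additionally assumed that every edge lying in no cycle has weight at most δ; without this the claim fails (a single edge of weight 1 with δ = 0 gives two points and no cycles). Nothing is added for n ≥ 1. *)

(* Defs.v *)
From HB Require Import structures.
From mathcomp Require Import all_boot all_order all_algebra.
From mathcomp Require Import all_classical all_reals ereal.

Set Implicit Arguments.
Unset Strict Implicit.
Unset Printing Implicit Defensive.

Import Order.TTheory GRing.Theory Num.Theory.

Local Open Scope ring_scope.

(* U / W for W included in U; in general U / (U :&: W). *)
Section QuotientSpace.
Variables (F : fieldType) (V : vectType F) (U W : {vspace V}).

Definition quotv_mod : {pred subvs_of U} := fun u => vsval u \in W.

Fact quotv_mod_zmod_closed : zmod_closed quotv_mod.
Proof.
split=> [|u v uW vW]; rewrite /quotv_mod unfold_in ?linear0 ?mem0v //.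
by rewrite linearB rpredB.
Qed.

HB.instance Definition _ :=
  GRing.isZmodClosed.Build (subvs_of U) quotv_mod quotv_mod_zmod_closed.

Definition quotv : Type := Quotient.quot quotv_mod.

HB.instance Definition _ := GRing.Zmodule.on quotv.

Definition quotv_pi (u : subvs_of U) : quotv := \pi_(Quotient.quot quotv_mod)%qT u.

Definition quotv_scale (a : F) (q : quotv) : quotv :=
  quotv_pi (a *: repr (q : Quotient.quot quotv_mod)).

Lemma quotv_piE u v : (quotv_pi u == quotv_pi v) = (vsval (u - v) \in W).
Proof. by rewrite /quotv_pi -Quotient.idealrBE. Qed.

Lemma quotv_surj (q : quotv) : exists u, q = quotv_pi u.
Proof. by exists (repr (q : Quotient.quot quotv_mod)); exact/esym/reprK. Qed.

Lemma quotv_piD u v : quotv_pi (u + v) = quotv_pi u + quotv_pi v.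
Proof. exact: (Quotient.pi_add quotv_mod u v). Qed.

Lemma quotv_piZ a u : quotv_pi (a *: u) = quotv_scale a (quotv_pi u).
Proof.
apply/eqP; rewrite quotv_piE -scalerBr linearZ rpredZ // -quotv_piE.
by rewrite /quotv_pi reprK.
Qed.

Fact quotv_scaleA a b q :
  quotv_scale a (quotv_scale b q) = quotv_scale (a * b) q.
Proof. by have [u ->] := quotv_surj q; rewrite -!quotv_piZ scalerA. Qed.

Fact quotv_scale1 : left_id 1 quotv_scale.
Proof. by move=> q; have [u ->] := quotv_surj q; rewrite -quotv_piZ scale1r. Qed.

Fact quotv_scaleDr : right_distributive quotv_scale +%R.
Proof.
move=> a p q; have [u ->] := quotv_surj p; have [v ->] := quotv_surj q.
by rewrite -quotv_piD -!quotv_piZ -quotv_piD scalerDr.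
Qed.

Fact quotv_scaleDl q : {morph quotv_scale^~ q : a b / a + b}.
Proof.
move=> a b; have [u ->] := quotv_surj q.
by rewrite -!quotv_piZ -quotv_piD scalerDl.
Qed.

HB.instance Definition _ := GRing.Zmodule_isLmodule.Build F quotv
  quotv_scaleA quotv_scale1 quotv_scaleDr quotv_scaleDl.

End QuotientSpace.

(* Finite external direct sum, realised as a dependent product. *)
Section DirectSum.
Variables (F : fieldType) (I : finType) (V : I -> lmodType F).

Definition dirsum : Type := forall i, V i.

HB.instance Definition _ := Choice.on dirsum.

Definition dirsum_zero : dirsum := fun=> 0.
Definition dirsum_opp (u : dirsum) : dirsum := fun i => - u i.
Definition dirsum_add (u v : dirsum) : dirsum := fun i => u i + v i.
Definition dirsum_scale (a : F) (u : dirsum) : dirsum := fun i => a *: u i.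

Fact dirsum_addA : associative dirsum_add.
Proof. by move=> u v w; apply/functional_extensionality_dep => i; exact: addrA. Qed.

Fact dirsum_addC : commutative dirsum_add.
Proof. by move=> u v; apply/functional_extensionality_dep => i; exact: addrC. Qed.

Fact dirsum_add0 : left_id dirsum_zero dirsum_add.
Proof. by move=> u; apply/functional_extensionality_dep => i; exact: add0r. Qed.

Fact dirsum_addN : left_inverse dirsum_zero dirsum_opp dirsum_add.
Proof. by move=> u; apply/functional_extensionality_dep => i; exact: addNr. Qed.

HB.instance Definition _ := GRing.isZmodule.Build dirsum
  dirsum_addA dirsum_addC dirsum_add0 dirsum_addN.

Fact dirsum_scaleA a b u :
  dirsum_scale a (dirsum_scale b u) = dirsum_scale (a * b) u.
Proof. by apply/functional_extensionality_dep => i; exact: scalerA. Qed.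

Fact dirsum_scale1 : left_id 1 dirsum_scale.
Proof. by move=> u; apply/functional_extensionality_dep => i; exact: scale1r. Qed.

Fact dirsum_scaleDr : right_distributive dirsum_scale +%R.
Proof. by move=> a u v; apply/functional_extensionality_dep => i; exact: scalerDr. Qed.

Fact dirsum_scaleDl u : {morph dirsum_scale^~ u : a b / a + b}.
Proof. by move=> a b; apply/functional_extensionality_dep => i; exact: scalerDl. Qed.

HB.instance Definition _ := GRing.Zmodule_isLmodule.Build F dirsum
  dirsum_scaleA dirsum_scale1 dirsum_scaleDr dirsum_scaleDl.

End DirectSum.

Definition lmod_iso (F : fieldType) (U V : lmodType F) : Prop :=
  exists f : {linear U -> V}, bijective f.

(* A simplicial complex on X is given by its set K of (nonempty) simplices.
   A chain is a function on all subsets of X, the basis vector of a simplex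
   being oriented by the order of enum. *)
Section SimplicialHomology.
Variables (R : realType) (X : finType).

Definition chain : vectType R := {ffun {set X} -> R^o}.

Definition simplex_chain (s : {set X}) : chain := [ffun t => (t == s)%:R].

(* Coordinates of the simplicial boundary
   [x_0, ..., x_m] |-> \sum_j (-1)^j [x_0, ..., x_(j-1), x_(j+1), ..., x_m]:
   t is the face of x |: t opposite to x. As set0 is an index, the boundary of
   a vertex is the generator in degree -1, i.e. this is the augmented complex. *)
Definition boundary (c : chain) : chain :=
  [ffun t : {set X} => \sum_(x | x \notin t)
     (-1) ^+ index x (enum (x |: t)) * c (x |: t)].

Fact boundary_is_linear : linear boundary.
Proof.
move=> a u v; apply/ffunP => t; rewrite !ffunE scaler_sumr -big_split /=.
by apply: eq_bigr => x _; rewrite !ffunE mulrDr /GRing.scale /= mulrCA.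
Qed.

HB.instance Definition _ :=
  GRing.isLinear.Build R chain chain _ boundary boundary_is_linear.

Variable K : {set {set X}}.

Definition chains (n : nat) : {vspace chain} :=
  <<[seq simplex_chain s | s in [set s in K | #|s| == n.+1]]>>%VS.

Definition cycles (n : nat) : {vspace chain} :=
  (chains n :&: lker (linfun boundary))%VS.

Definition boundaries (n : nat) : {vspace chain} :=
  (linfun boundary @: chains n.+1)%VS.

Definition reduced_homology (n : nat) : lmodType R :=
  quotv (cycles n) (boundaries n).

End SimplicialHomology.

Section UndirectedGraphs.
Variable X : finType.

(* s lists the vertices of a cycle in cyclic order. *)
Definition is_cycle (e : rel X) (s : seq X) : bool := ucycleb e s && (2 < size s)%N.

Definition cycle_edges (s : seq X) : {set {set X}} :=
  [set [set x; next s x] | x in s].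

(* Cycles are compared as subgraphs, i.e. through their edge sets: distinct
   cycles may have the same vertices. *)
Definition cactus (e : rel X) : Prop :=
  [/\ symmetric e, irreflexive e, (0 < #|X|)%N,
      forall x y, connect e x y
    & forall s t, is_cycle e s -> is_cycle e t ->
        cycle_edges s != cycle_edges t ->
        (#|[set x in s] :&: [set x in t]| <= 1)%N].

End UndirectedGraphs.

Record network (R : realType) := Network {
  vertex :> finType;
  weight : vertex -> vertex -> \bar R;
  weight_ge0 : forall x y, (0 <= weight x y)%E
}.

Section Networks.
Variables (R : realType) (G : network R).

Definition edge : rel G := [rel x y | (x != y) && (weight x y < +oo)%E].

Definition path_weight (x : G) (p : seq G) : \bar R :=
  (\sum_(w <- pairmap (@weight R G) x p) w)%E.

Definition dist (x y : G) : \bar R :=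
  ereal_inf [set l | exists p : seq G,
    [/\ path edge x p, last x p = y & l = path_weight x p]]%classic.

Definition dowker (delta : R) : {set {set G}} :=
  [set s : {set G} | (s != finset.set0) &&
     [exists y, [forall x in s, (dist y x <= delta%:E)%E]]].

Definition underlying : rel G := [rel x y | edge x y || edge y x].

(* G carries exactly one of the two orientations of every underlying edge. *)
Definition directed_cactus : Prop :=
  (forall x y, edge x y -> ~~ edge y x) /\ cactus underlying.

(* A subgraph is given by its vertices and directed edges. *)
Definition subgraph_data : finType := ({set G} * {set G * G})%type.

Definition is_subgraph (C : subgraph_data) : Prop :=
  forall x y, (x, y) \in C.2 -> [/\ edge x y, x \in C.1 & y \in C.1].

Definition is_cycle_subgraph (C : subgraph_data) : Prop :=
  is_subgraph C /\
  exists s : seq G,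
    [/\ is_cycle underlying s, C.1 = [set x in s]
      & [set [set a.1; a.2] | a in C.2] = cycle_edges s].

Definition cycle_subgraphs : {set subgraph_data} :=
  [set C | `[< is_cycle_subgraph C >]].

(* Pairs that are not edges of C get weight +oo, so that paths, hence distances,
   are those inside C. *)
Definition subgraph_weight (C : subgraph_data) (x y : {x : G | x \in C.1}) :
    \bar R :=
  if (x == y) || ((val x, val y) \in C.2) then weight (val x) (val y) else +oo%E.

Fact subgraph_weight_ge0 C x y : (0 <= @subgraph_weight C x y)%E.
Proof. by rewrite /subgraph_weight; case: ifP => // _; exact: weight_ge0. Qed.

Definition subnetwork (C : subgraph_data) : network R :=
  Network (@subgraph_weight_ge0 C).

(* A bridge heavier than delta contributes a class to the reduced H_0 of
   dowker delta that comes from no cycle: for a single edge of weight 1 and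
   delta = 0 the complex consists of two points. No other degree sees bridges. *)
Definition bridge (x y : G) : Prop :=
  edge x y /\ forall C, C \in cycle_subgraphs -> (x, y) \notin C.2.

End Networks.

(* Main.v *)
From HB Require Import structures.
From mathcomp Require Import all_boot all_order all_algebra.
From mathcomp Require Import all_classical all_reals ereal.
From mathcomp Require Import fintype finset.
Require Import Defs.

(* Call blocks the cycle subgraphs and the bridges. Every vertex x has a gate
   rho_C(x) in each block C: the only vertex of C that can be reached from x
   without using edges of C. A path from y to x is mapped by rho_C to a path
   in C that is no heavier, and it runs through rho_C(y) and rho_C(x) if these
   differ. So rho_C and the inclusion of C are simplicial for the Dowker
   complexes, and for a fixed vertex r the chain map
     id - r - sum_C (rho_C - rho_C(r))   (r and rho_C(r) as constant maps)
   sends each simplex s into a full simplex of the Dowker complex of G, spanned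
   by s and the sets rho_C(s) with rho_C not constant on s. It vanishes on
   vertices, where the sum telescopes along a path, hence it is null-homotopic.
   Constant maps kill cycles, and the gate map of a bridge is null-homologous, so
   the identity of the homology of G is the sum of the maps induced by rho_C
   over the cycle subgraphs. This makes the map to the direct sum injective; it
   is surjective because rho_C is the identity on C and constant on every other
   cycle. *)

Set Implicit Arguments.
Unset Strict Implicit.
Unset Printing Implicit Defensive.

Import Order.TTheory GRing.Theory Num.Theory.

Local Open Scope ring_scope.

(** * Chains as an exterior algebra *)

Section EnumOrder.
Variable X : finType.
Implicit Types (x y : X) (s t : {set X}).

Definition before : rel X := [rel x y | (index x (enum X) < index y (enum X))%N].

Lemma before_trans : transitive before.
Proof. by move=> y x z; apply: ltn_trans. Qed.

Lemma before_total x y : x != y -> before x y = ~~ before y x.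
Proof.
move=> xy; rewrite /before /= -leqNgt [RHS]leq_eqVlt; case: eqP => //.
by move/(index_inj x (mem_enum X x) (mem_enum X y)); move/eqP: xy.
Qed.

Lemma sorted_enum s : sorted before (enum s).
Proof.
rewrite /enum_mem; apply: sorted_filter; first exact: before_trans.
rewrite -enumT; have uE := enum_uniq X; rewrite /before.
(* The case analysis serves only to supply [x], the default element that [sortedP] asks for. *)
elim/last_ind: {-1}(enum X) (erefl (enum X)) => [//|l x _] E; rewrite -E.
by apply/(sortedP x) => i i_lt /=; rewrite !index_uniq // ltnW.
Qed.

Lemma index_sorted x (l : seq X) :
  sorted before l -> x \in l -> index x l = count (before^~ x) l.
Proof.
elim: l => [//|y l IH] /= sl; rewrite inE [x == y]eq_sym.
have /allP yl : all (before y) l := order_path_min before_trans sl.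
have [yx _|yx /= xl] := eqVneq y x.
  rewrite -yx {1}/before /= ltnn add0n; apply/esym/eqP.
  rewrite -leqn0 leqNgt -has_count; apply/hasPn => z zl.
  by rewrite /before /= -leqNgt ltnW //; exact: yl.
by rewrite IH ?(path_sorted sl) // (yl x xl).
Qed.

End EnumOrder.

Section Exterior.
Variables (R : realType) (X : finType).
Implicit Types (x y : X) (s t : {set X}) (c : chain R X).

(** For [x] outside [t], the sign relating the product of [x] with the sorted product of [t] to the
    sorted product of [x |: t]: [x] moves past the elements of [t] before it. *)
Definition insert_sign x t : R := (-1) ^+ #|[set y in t | before y x]|.

Lemma insert_signK x t : insert_sign x t * insert_sign x t = 1.
Proof. by rewrite -expr2 sqrr_sign. Qed.

Lemma insert_signU1 x y t : y \notin t ->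
  insert_sign x (y |: t) = (-1) ^+ before y x * insert_sign x t.
Proof.
move=> yt; rewrite -exprD; congr (_ ^+ _).
have [yx|yx] := boolP (before y x).
  have -> : [set z in y |: t | before z x] = y |: [set z in t | before z x].
    by apply/setP => z; rewrite !inE; case: eqP => //= ->.
  by rewrite cardsU1 !inE (negbTE yt).
rewrite add0n; congr #|pred_of_set _|; apply/setP => z; rewrite !inE.
by case: eqP => //= ->; rewrite (negbTE yx) andbF.
Qed.

Lemma index_enumU1 x t : x \notin t ->
  index x (enum (x |: t)) = #|[set y in t | before y x]|.
Proof.
move=> xt; rewrite (index_sorted (sorted_enum _)) ?mem_enum ?setU11 //.
rewrite -size_filter.
have /card_uniqP <- : uniq [seq y <- enum (x |: t) | before y x].
  by rewrite filter_uniq ?enum_uniq.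
apply: eq_card => y; rewrite mem_filter mem_enum !inE andbC.
by case: eqP => //= ->; rewrite (negbTE xt) /before /= ltnn.
Qed.

Lemma boundaryE c t :
  boundary c t = \sum_(x | x \notin t) insert_sign x t * c (x |: t).
Proof. by rewrite ffunE; apply: eq_bigr => x xt; rewrite index_enumU1. Qed.

(* Left exterior multiplication by x. Subsets of X index a basis of the exterior
   algebra on X, on which the boundary is the contraction by the linear form
   sending every x to 1, hence an antiderivation (boundary_cone). *)
Definition cone x c : chain R X :=
  [ffun t : {set X} =>
     if x \in t then insert_sign x (t :\ x) * c (t :\ x) else 0].

Fact cone_is_linear x : linear (cone x).
Proof.
move=> a u v; apply/ffunP => t; rewrite !ffunE; case: ifP => _.
  by rewrite mulrDr /GRing.scale /= mulrCA.
by rewrite scaler0 addr0.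
Qed.

HB.instance Definition _ x :=
  GRing.isLinear.Build R (chain R X) (chain R X) _ (cone x) (cone_is_linear x).

Lemma boundary_cone x c : boundary (cone x c) = c - cone x (boundary c).
Proof.
apply/ffunP => t; rewrite boundaryE 3!ffunE.
have [xt|xt] := ifPn; last first.
  rewrite subr0 (bigD1 x) //= ffunE setU11 setU1K // mulrA insert_signK mul1r.
  rewrite big1 ?addr0 // => y /andP[yt yx].
  by rewrite ffunE !inE eq_sym (negbTE yx) (negbTE xt) mulr0.
set u := t :\ x; have xu : x \notin u by rewrite !inE eqxx.
have tE : t = x |: u by rewrite setD1K.
(* The summand of [x] in the boundary at [u] cancels [c t]; the others match because inserting [x]
   and inserting [y] anticommute. *)
rewrite boundaryE [X in _ = _ - _ * X](bigD1 x) //= -tE mulrDr mulrA insert_signK mul1r.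
rewrite opprD addrA subrr sub0r mulr_sumr -sumrN.
apply: eq_big => [y|y yt]; first by rewrite tE !inE negb_or andbC.
have /andP[yx yu] : (y != x) && (y \notin u).
  by move: yt; rewrite tE !inE negb_or.
rewrite ffunE !inE xt orbT.
have -> : (y |: t) :\ x = y |: u.
  by apply/setP => z; rewrite !inE; case: eqP => //= ->; rewrite eq_sym (negbTE yx).
rewrite tE !insert_signU1 // (before_total yx).
by case: (before x y); rewrite /= !(expr0, expr1, mul1r, mulN1r, mulrN, mulNr) !mulrA
  [insert_sign y u * _]mulrC.
Qed.

Lemma cone_anticomm x y c : x != y -> cone x (cone y c) = - cone y (cone x c).
Proof.
move=> xy; apply/ffunP => t; rewrite !ffunE !inE [y == x]eq_sym xy /=.
have [xt|xt] := boolP (x \in t); have [yt|yt] := boolP (y \in t);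
  rewrite ?mulr0 ?oppr0 //.
have -> : t :\ y :\ x = t :\ x :\ y by apply/setP => z; rewrite !inE andbCA.
set u := t :\ x :\ y.
have -> : t :\ x = y |: u by rewrite setD1K // !inE eq_sym xy.
have -> : t :\ y = x |: u.
  apply/setP => z; rewrite !inE.
  by case: (eqVneq z x) => [->|] //=; rewrite xy xt.
rewrite !insert_signU1 ?inE ?eqxx ?andbF // (before_total xy).
by case: (before y x); rewrite /= !(expr0, expr1, mul1r, mulN1r, mulrN, mulNr, opprK) !mulrA
  [insert_sign y u * _]mulrC.
Qed.

Lemma cone_cone x c : cone x (cone x c) = 0.
Proof.
by apply/ffunP => t; rewrite !ffunE !inE eqxx /= mulr0 if_same.
Qed.

Lemma simplex_chainE s t : simplex_chain R s t = (t == s)%:R.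
Proof. by rewrite ffunE. Qed.

Lemma cone_simplex x s : cone x (simplex_chain R s) =
  if x \in s then 0 else insert_sign x s *: simplex_chain R (x |: s).
Proof.
apply/ffunP => t; rewrite [LHS]ffunE; case: ifPn => [xt|xt].
  rewrite simplex_chainE; case: ifPn => xs.
    by rewrite [RHS]ffunE; case: eqP => [E|]; [rewrite -E !inE eqxx in xs | rewrite mulr0].
  rewrite !ffunE /GRing.scale /=; case: eqP => [<-|ne]; first by rewrite setD1K ?eqxx.
  by case: eqP => [E|]; rewrite ?mulr0 //; case: ne; rewrite E setU1K.
case: ifPn => xs; rewrite !ffunE //.
by case: eqP xt => [->|]; rewrite ?setU11 // scaler0.
Qed.

Lemma chain_sum c : c = \sum_s c s *: simplex_chain R s.
Proof.
apply/ffunP => t; rewrite sum_ffunE (bigD1 t) //= !ffunE eqxx big1 ?addr0 => [|s st].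
  by rewrite /GRing.scale /= mulr1.
by rewrite !ffunE eq_sym (negbTE st) scaler0.
Qed.

Lemma linear_ext (V : lmodType R) (f g : {linear chain R X -> V}) :
  (forall s, f (simplex_chain R s) = g (simplex_chain R s)) -> f =1 g.
Proof.
move=> fg c; rewrite [c]chain_sum !linear_sum.
by apply: eq_bigr => s _; rewrite !linearZ /= fg.
Qed.

Lemma boundary_empty : boundary (simplex_chain R (set0 : {set X})) = 0.
Proof.
apply/ffunP => t; rewrite boundaryE big1 ?ffunE // => x _.
rewrite simplex_chainE; case: eqP => [/setP/(_ x)|]; last by rewrite mulr0.
by rewrite !inE eqxx.
Qed.

Definition extend (V : lmodType R) (h : {set X} -> V) c : V := \sum_s c s *: h s.

Fact extend_is_linear (V : lmodType R) h : linear (@extend V h).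
Proof.
move=> a u v; rewrite /extend scaler_sumr -big_split /=; apply: eq_bigr => s _.
by rewrite !ffunE scalerDl scalerA.
Qed.

HB.instance Definition _ (V : lmodType R) h :=
  GRing.isLinear.Build R (chain R X) V _ (@extend V h) (@extend_is_linear V h).

Lemma extend_simplex (V : lmodType R) h s : @extend V h (simplex_chain R s) = h s.
Proof.
rewrite /extend (bigD1 s) //= simplex_chainE eqxx scale1r big1 ?addr0 // => t.
by rewrite simplex_chainE => /negbTE ->; rewrite scale0r.
Qed.

(** The exterior product of a list: an oriented simplex with its vertices in any order, zero as soon
    as a vertex repeats. Degenerate images of simplices thus need no separate case. *)
Definition seq_chain (l : seq X) : chain R X := foldr cone (simplex_chain R set0) l.

Lemma cone_seq_mem x l : x \in l -> cone x (seq_chain l) = 0.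
Proof.
elim: l => [//|y l IH]; rewrite inE /=; case: (eqVneq x y) => [-> _|xy /= xl].
  exact: cone_cone.
by rewrite cone_anticomm // IH // linear0 oppr0.
Qed.

Lemma seq_chain_swap x l1 l2 :
  seq_chain (l1 ++ x :: l2) = (-1) ^+ size l1 *: seq_chain (x :: l1 ++ l2).
Proof.
elim: l1 => [|y l1 IH] /=; first by rewrite scale1r.
rewrite IH /= linearZ /= exprS -scalerA; have [->|xy] := eqVneq x y.
  by rewrite !cone_cone !scaler0.
by rewrite (cone_anticomm _ xy) scalerN scaleN1r opprK.
Qed.

Lemma seq_chain_sorted (l : seq X) :
  sorted (@before X) l -> seq_chain l = simplex_chain R [set x in l].
Proof.
elim: l => [_|x l IH] /=; first by congr simplex_chain; apply/setP => x; rewrite !inE.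
move=> sl; have /allP xl := order_path_min (@before_trans X) sl.
rewrite IH ?(path_sorted sl) // cone_simplex inE; case: ifP => [/xl|xl'].
  by rewrite /before /= ltnn.
rewrite /insert_sign (_ : [set y in _ | _] = set0) ?cards0 ?scale1r.
  by congr simplex_chain; apply/setP => y; rewrite !inE.
apply/setP => y; rewrite !inE; apply/negP => /andP[yl].
by rewrite /before /= ltnNge ltnW //; exact: xl.
Qed.

Lemma seq_chain_enum s : seq_chain (enum s) = simplex_chain R s.
Proof.
by rewrite seq_chain_sorted ?sorted_enum // set_enum.
Qed.

Lemma seq_chain_supp (l : seq X) t :
  seq_chain l t != 0 -> uniq l /\ t = [set x in l].
Proof.
elim: l t => [|x l IH] t /=.
  rewrite simplex_chainE; case: (eqVneq t set0) => [-> _|_]; last by rewrite eqxx.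
  by split=> //; apply/setP => x; rewrite !inE.
rewrite ffunE; case: ifPn => [xt|]; last by rewrite eqxx.
rewrite mulf_eq0 negb_or => /andP[_ /IH[-> E]].
have xl : x \notin l by move/setP/(_ x): E; rewrite !inE eqxx /= => <-.
split; first by rewrite xl.
by rewrite -(setD1K xt) E; apply/setP => y; rewrite !inE.
Qed.

(** Applying [boundary_cone] twice leaves only a cone over a double boundary, so induction on the
    factors of a simplex applies. *)
Lemma boundary_boundary c : boundary (boundary c) = 0.
Proof.
apply: (linear_ext (f := @boundary R X \o @boundary R X) (g := \0)) => s /=.
rewrite -seq_chain_enum; elim: (enum s) => [|x l IH] /=.
  by rewrite boundary_empty linear0.
by rewrite boundary_cone linearB /= boundary_cone IH linear0 subr0 subrr.
Qed.

Lemma boundary_simplex_supp s t :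
  boundary (simplex_chain R s) t != 0 -> t \subset s /\ #|s| = #|t|.+1.
Proof.
move=> bt; suff [x xt <-] : exists2 x, x \notin t & x |: t = s.
  by rewrite subsetUr cardsU1 xt.
apply: contrapT => no; case/eqP: bt; rewrite boundaryE big1 // => x xt.
rewrite simplex_chainE; case: eqP => [E|]; last by rewrite mulr0.
by case: no; exists x.
Qed.

End Exterior.

(** * Chain maps induced by vertex maps *)

Section Pushforward.
Variable R : realType.
Implicit Types X Y Z : finType.

(** The morphism of exterior algebras induced by [f], which is the simplicial chain map with
    degenerate images sent to zero. *)
Definition push X Y (f : X -> Y) : chain R X -> chain R Y :=
  extend (fun s => seq_chain R (map f (enum s))).

HB.instance Definition _ X Y (f : X -> Y) := GRing.Linear.on (push f).

Lemma push_simplex X Y (f : X -> Y) s :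
  push f (simplex_chain R s) = seq_chain R (map f (enum s)).
Proof. exact: extend_simplex. Qed.

(** Multiplicativity of [push f]. The number of entries before [x] in [enum (x |: s)] gives both the
    sign of inserting [x] and that of moving [f x] to the front, so the two cancel. *)
Lemma push_cone X Y (f : X -> Y) x c :
  push f (cone x c) = cone (f x) (push f c).
Proof.
apply: (linear_ext (f := push f \o cone x) (g := cone (f x) \o push f)) => s /=.
rewrite push_simplex cone_simplex; case: ifPn => [xs|xs].
  by rewrite linear0 cone_seq_mem // map_f // mem_enum.
rewrite linearZ /= push_simplex /insert_sign -index_enumU1 //.
have [l1 [l2 E]] : exists l1 l2, enum (x |: s) = l1 ++ x :: l2.
  have xe : x \in enum (x |: s) by rewrite mem_enum setU11.
  by case/splitPr: xe => l1 l2; exists l1, l2.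
have := enum_uniq (x |: s); rewrite E cat_uniq /= negb_or -andbA.
case/and5P=> _ xl1 _ xl2 _.
have -> : enum s = l1 ++ l2.
  transitivity [seq y <- enum (x |: s) | y != x].
    rewrite /enum_mem -filter_predI; apply: eq_filter => y /=.
    by rewrite !inE; case: eqP => //= ->; apply/negbTE.
  have flt l : x \notin l -> [seq y <- l | y != x] = l.
    by move=> xl; apply/all_filterP/allP => y yl; apply: contraNneq xl => <-.
  by rewrite E filter_cat /= eqxx /= !flt.
rewrite index_cat (negbTE xl1) /= eqxx addn0 !map_cat seq_chain_swap size_map.
by rewrite scalerA -expr2 sqrr_sign scale1r.
Qed.

Lemma push_seq X Y (f : X -> Y) l :
  push f (seq_chain R l) = seq_chain R (map f l).
Proof.
elim: l => [|x l IH] /=; first by rewrite push_simplex enum_set0.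
by rewrite push_cone IH.
Qed.

Lemma push_boundary X Y (f : X -> Y) c :
  push f (boundary c) = boundary (push f c).
Proof.
apply: (linear_ext (f := push f \o @boundary R X) (g := @boundary R Y \o push f)) => s /=.
rewrite -seq_chain_enum push_seq; elim: (enum s) => [|x l IH] /=.
  by rewrite !boundary_empty linear0.
by rewrite !boundary_cone linearB /= push_cone IH push_seq.
Qed.

Lemma push_comp X Y Z (f : X -> Y) (g : Y -> Z) c :
  push g (push f c) = push (g \o f) c.
Proof.
apply: (linear_ext (f := push g \o push f) (g := push (g \o f))) => s /=.
by rewrite !push_simplex push_seq map_comp.
Qed.

Lemma eq_push X Y (f g : X -> Y) : f =1 g -> push f =1 push g.
Proof.
by move=> fg c; apply: eq_bigr => s _; congr (_ *: seq_chain R _); exact: eq_map.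
Qed.

Lemma push_id X c : push (@id X) c = c.
Proof.
apply: (linear_ext (f := push id) (g := idfun)) => s /=.
by rewrite push_simplex map_id seq_chain_enum.
Qed.

Lemma push_simplex_supp X Y (f : X -> Y) s t :
  push f (simplex_chain R s) t != 0 -> {in s &, injective f} /\ t = [set f x | x in s].
Proof.
rewrite push_simplex => /seq_chain_supp[u ->]; split.
  apply/imset_injP; rewrite [X in _ == X]cardE -(size_map f) -(card_uniqP u).
  by apply/eqP/eq_card => y; apply/imsetP/mapP => -[x xs ->]; exists x;
    rewrite // ?mem_enum // -mem_enum.
apply/setP => y; rewrite inE; apply/mapP/imsetP => -[x xs ->]; exists x;
  by rewrite // ?mem_enum // -mem_enum.
Qed.

Lemma push_supp X Y (f : X -> Y) c t :
  push f c t != 0 ->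
  exists s, [/\ c s != 0, {in s &, injective f} & t = [set f x | x in s]].
Proof.
move=> ct; suff [s cs pt] : exists2 s, c s != 0 & push f (simplex_chain R s) t != 0.
  by exists s; have [] := push_simplex_supp pt.
apply: contrapT => no; case/eqP: ct; rewrite [c]chain_sum linear_sum sum_ffunE.
apply: big1 => s _; rewrite linearZ /= ffunE.
have [->|cs] := eqVneq (c s) 0; first by rewrite scale0r.
have [->|pt] := eqVneq (push f (simplex_chain R s) t) 0; first by rewrite scaler0.
by case: no; exists s.
Qed.

End Pushforward.

(** * Homology *)

Section Homology.
Variable R : realType.
Implicit Types X Y : finType.

Lemma chainsP X (K : {set {set X}}) n (c : chain R X) :
  reflect (forall t, c t != 0 -> t \in K /\ #|t| = n.+1) (c \in chains R K n).
Proof.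
apply: (iffP idP) => [cK t|cK].
  pose S := [seq simplex_chain R s | s in [set s in K | #|s| == n.+1]].
  have cS : c \in <<S>>%VS := cK; rewrite (coord_span (X := in_tuple S) cS) sum_ffunE.
  move=> ct; have [i Si] : exists i : 'I_(size S), S`_i t != 0.
    apply: contrapT => no; case/eqP: ct; apply: big1 => i _; rewrite ffunE /=.
    have [->|Si] := eqVneq (S`_i t) 0; first by rewrite scaler0.
    by case: no; exists i.
  have /imageP[s] : S`_i \in S by exact: mem_nth.
  rewrite inE => /andP[sK /eqP sn] Ss; move: Si; rewrite Ss simplex_chainE.
  by case: (eqVneq t s) => [->|_]; rewrite ?eqxx.
rewrite [c]chain_sum; apply: memv_suml => s _.
have [->|cs] := eqVneq (c s) 0; first by rewrite scale0r mem0v.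
have [sK sn] := cK s cs; apply/memvZ/memv_span/imageP; exists s => //.
by rewrite inE sK sn /=.
Qed.

Lemma cyclesE X (K : {set {set X}}) n (c : chain R X) :
  (c \in cycles R K n) = (c \in chains R K n) && (boundary c == 0).
Proof. by rewrite memv_cap memv_ker lfunE. Qed.

Lemma boundariesP X (K : {set {set X}}) n (c : chain R X) :
  reflect (exists2 d, d \in chains R K n.+1 & c = boundary d)
    (c \in boundaries R K n).
Proof.
by apply: (iffP memv_imgP) => -[d dK ->]; exists d; rewrite ?lfunE.
Qed.

Lemma cone_boundary X (K : {set {set X}}) n x (z : chain R X) :
  boundary z = 0 -> cone x z \in chains R K n.+1 -> z \in boundaries R K n.
Proof.
move=> z0 zK; apply/boundariesP; exists (cone x z) => //.
by rewrite boundary_cone z0 linear0 subr0.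
Qed.

Section Simplicial.
Variables (X Y : finType) (K : {set {set X}}) (L : {set {set Y}}) (f : X -> Y).
Hypothesis fKL : forall s, s \in K -> [set f x | x in s] \in L.

Lemma push_chains n c : c \in chains R K n -> push f c \in chains R L n.
Proof.
move=> /chainsP cK; apply/chainsP => t /push_supp[s [/cK[sK sn] fs ->]].
by rewrite fKL // card_in_imset.
Qed.

Lemma push_cycles n c : c \in cycles R K n -> push f c \in cycles R L n.
Proof.
rewrite !cyclesE => /andP[cK /eqP c0].
by rewrite push_chains //= -push_boundary c0 linear0.
Qed.

Lemma push_boundaries n c : c \in boundaries R K n -> push f c \in boundaries R L n.
Proof.
move=> /boundariesP[d dK ->]; apply/boundariesP; exists (push f d).
  exact: push_chains.
by rewrite push_boundary.
Qed.

End Simplicial.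

(* An acyclic carrier argument: Phi s spans a full simplex of K, hence a chain
   homotopy from f to 0 can be built by coning off, one dimension at a time. *)
Lemma carried_boundary X (K : {set {set X}}) (f : {linear chain R X -> chain R X})
    (Phi : {set X} -> {set X}) :
  (forall c, f (boundary c) = boundary (f c)) ->
  f (simplex_chain R set0) = 0 ->
  (forall s t : {set X}, f (simplex_chain R s) t != 0 -> t \subset Phi s /\ #|t| = #|s|) ->
  (forall s : {set X}, s \subset Phi s) ->
  {homo Phi : s t / s \subset t} ->
  (forall s t : {set X}, s \in K -> t \subset Phi s -> t != set0 -> t \in K) ->
  forall n z, z \in cycles R K n -> f z \in boundaries R K n.
Proof.
move=> f_boundary f0 f_supp sub_Phi Phi_homo Phi_K.
(* Given a homotopy [h] on the faces of [s], the chain still to be bounded is a cycle; coning it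
   from a vertex of [s] fills it. *)
pose step (h : {set X} -> chain R X) (s : {set X}) : chain R X :=
  if [pick x in s] is Some x then
    cone x (f (simplex_chain R s) - extend h (boundary (simplex_chain R s)))
  else 0.
(* The index counts vertices: [H k] is meant for simplices with [k] vertices and starts from zero on
   the empty one. *)
pose H k := iter k step (fun=> 0).
have extend_supp k c t : extend (H k) c t != 0 -> exists2 s, c s != 0 & H k s t != 0.
  move=> ct; apply: contrapT => no; case/eqP: ct; rewrite sum_ffunE big1 // => s _.
  rewrite ffunE; have [->|cs] := eqVneq (c s) 0; first by rewrite scale0r.
  have [->|Hs] := eqVneq (H k s t) 0; first by rewrite scaler0.
  by case: no; exists s.
have extend_boundary k (c : chain R X) : (forall s, c s != 0 ->
      boundary (H k s) = f (simplex_chain R s)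
        - extend (H k.-1) (boundary (simplex_chain R s))) ->
    boundary (extend (H k) c) = f c - extend (H k.-1) (boundary c).
  move=> cH; have lin (g : {linear chain R X -> chain R X}) :
      g c = \sum_s c s *: g (simplex_chain R s).
    by rewrite {1}[c]chain_sum linear_sum; apply: eq_bigr => s _; rewrite linearZ.
  have /= -> := lin (extend (H k.-1) \o @boundary R X).
  rewrite (lin f) linear_sum -sumrB; apply: eq_bigr => s _.
  rewrite linearZ /= -scalerBr.
  by have [->|cs] := eqVneq (c s) 0; rewrite ?scale0r // cH.
(* The homotopy equation and the support bound, proved together. For [k = 0] the truncated [k.-1] is
   harmless, as the empty simplex has zero boundary. *)
have HP k : forall s : {set X}, #|s| = k ->
    boundary (H k s) = f (simplex_chain R s)
      - extend (H k.-1) (boundary (simplex_chain R s)) /\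
    forall t, H k s t != 0 -> t \subset Phi s /\ #|t| = k.+1.
  elim: k => [|k IH] s sk.
    have -> : s = set0 by apply/eqP; rewrite -cards_eq0 sk.
    rewrite f0 boundary_empty !linear0 addr0; split=> // t.
    by rewrite ffunE eqxx.
  have -> : H k.+1 s = step (H k) s by [].
  rewrite /step /=; case: pickP => [x xs|s0]; last first.
    by move: sk; rewrite eq_card0.
  split=> [|t].
    rewrite boundary_cone linearB /= extend_boundary => [|t].
      by rewrite f_boundary boundary_boundary linear0 subr0 subrr linear0 subr0.
    move=> /boundary_simplex_supp[_]; rewrite sk => -[tk].
    by have [] := IH t (esym tk).
  rewrite ffunE; case: ifPn => [xt|]; last by rewrite eqxx.
  rewrite mulf_eq0 negb_or => /andP[_ wt].
  suff [tP tk] : t :\ x \subset Phi s /\ #|t :\ x| = k.+1.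
    split; last by rewrite (cardsD1 x) xt tk.
    by rewrite -(setD1K xt) subUset tP sub1set (subsetP (sub_Phi s)).
  (* The face comes either from [f] or from the homotopy on a face [u] of [s]; in the second case
     monotonicity puts [Phi u] inside [Phi s]. *)
  have [E|/f_supp] := eqVneq (f (simplex_chain R s) (t :\ x)) 0; last by rewrite sk.
  move: wt; rewrite 2!ffunE E sub0r oppr_eq0 => /extend_supp[u].
  move=> /boundary_simplex_supp[us]; rewrite sk => -[uk].
  move=> /(IH u (esym uk)).2[tu tk]; split=> //.
  exact: subset_trans tu (Phi_homo _ _ us).
move=> n z; rewrite cyclesE => /andP[/chainsP zK /eqP z0].
(* Simplices of dimension [n] have [n.+1] vertices; since [z] is a cycle, the homotopy equation says
   that this chain has boundary [f z]. *)
apply/boundariesP; exists (extend (H n.+1) z).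
  apply/chainsP => t /extend_supp[s /zK[sK sn] /(HP _ _ sn).2[ts tn]].
  by split=> //; apply: Phi_K sK ts _; rewrite -card_gt0 tn.
rewrite extend_boundary => [|s /zK[_ sn]]; last exact: (HP _ _ sn).1.
by rewrite z0 linear0 subr0.
Qed.

End Homology.

(** * Isomorphisms from a quotient to a direct sum of quotients *)

Lemma quotv_pi_eq0 (F : fieldType) (V : vectType F) (U W : {vspace V})
  (u : subvs_of U) : (quotv_pi W u == 0) = (vsval u \in W).
Proof.
suff <- : quotv_pi W (0 : subvs_of U) = 0 by rewrite quotv_piE subr0.
by apply: (addrI (quotv_pi W 0)); rewrite -quotv_piD !addr0.
Qed.

Section QuotientIso.
Variables (F : fieldType) (V : vectType F) (Z B : {vspace V}).
Variables (I : finType) (W : I -> vectType F).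
Variables (Z' B' : forall i, {vspace W i}) (p : forall i, {linear V -> W i}).
Hypothesis pZ : forall i v, v \in Z -> p i v \in Z' i.
Hypothesis pB : forall i v, v \in B -> p i v \in B' i.

Definition quot_lift (q : quotv Z B) : subvs_of Z := projT1 (cid (quotv_surj q)).

Definition quot_map (q : quotv Z B) : dirsum (fun i => quotv (Z' i) (B' i)) :=
  fun i => quotv_pi (B' i) (vsproj (Z' i) (p i (vsval (quot_lift q)))).

(** Two lifts of a class differ by an element of [B], which [p i] sends into [B' i], so the choice
    in [quot_lift] is immaterial. *)
Lemma quot_map_pi u i :
  quot_map (quotv_pi B u) i = quotv_pi (B' i) (vsproj (Z' i) (p i (vsval u))).
Proof.
apply/eqP; rewrite quotv_piE linearB /= !vsprojK ?pZ ?subvsP // -linearB pB //.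
rewrite -linearB -quotv_piE eq_sym; apply/eqP.
exact: projT2 (cid (quotv_surj (quotv_pi B u))).
Qed.

Fact quot_map_is_linear : linear quot_map.
Proof.
move=> a q r; apply: functional_extensionality_dep => i.
have [u ->] := quotv_surj q; have [v ->] := quotv_surj r.
have -> : a *: quotv_pi B u + quotv_pi B v = quotv_pi B (a *: u + v).
  by rewrite quotv_piD quotv_piZ.
transitivity (a *: quot_map (quotv_pi B u) i + quot_map (quotv_pi B v) i) => //.
rewrite !quot_map_pi !linearP.
by rewrite quotv_piD quotv_piZ.
Qed.

HB.instance Definition _ := GRing.isLinear.Build F (quotv Z B)
  (dirsum (fun i => quotv (Z' i) (B' i))) _ quot_map quot_map_is_linear.

(** The two premises are injectivity and surjectivity of [quot_map], phrased on representatives. *)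
Lemma lmod_iso_quotv :
  (forall v, v \in Z -> (forall i, p i v \in B' i) -> v \in B) ->
  (forall w : (forall i, W i), (forall i, w i \in Z' i) ->
     exists2 v, v \in Z & forall i, p i v - w i \in B' i) ->
  lmod_iso (quotv Z B) (dirsum (fun i => quotv (Z' i) (B' i))).
Proof.
move=> inj surj; exists quot_map.
have map_inj : injective quot_map.
  apply: raddf_inj => q; have [u ->] := quotv_surj q => u0.
  apply/eqP; rewrite quotv_pi_eq0; apply: inj (subvsP u) _ => i.
  have /eqP : quot_map (quotv_pi B u) i = 0.
    exact: (congr1 (fun w : dirsum _ => w i) u0).
  by rewrite quot_map_pi quotv_pi_eq0 vsprojK // pZ // subvsP.
have map_surj w : exists q, quot_map q = w.
  have [v vZ vw] := surj (fun i => vsval (projT1 (cid (quotv_surj (w i)))))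
    (fun i => subvsP _).
  exists (quotv_pi B (vsproj Z v)); apply: functional_extensionality_dep => i.
  rewrite quot_map_pi vsprojK //; have := vw i.
  case: (cid (quotv_surj (w i))) => u /= -> uB; apply/eqP.
  by rewrite quotv_piE linearB /= vsprojK // pZ.
exists (fun w => projT1 (cid (map_surj w))) => [q|w].
  by apply: map_inj; case: cid.
by case: cid.
Qed.

End QuotientIso.

(** * Cactus graphs *)

Section UndirectedCycles.
Variables (X : finType) (e : rel X).
Implicit Types (E : {set {set X}}) (s : seq X).

Definition off E : rel X := [rel x y | e x y && ([set x; y] \notin E)].

Lemma off_sym E : symmetric e -> symmetric (off E).
Proof. by move=> esym x y; rewrite /off /= esym [[set y; x]]setUC. Qed.

Lemma eq_set2 (x y a b : X) :
  [set x; y] = [set a; b] -> (x = a /\ y = b) \/ (x = b /\ y = a).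
Proof.
move=> /setP E; move: (E x) (E y) (E a) (E b); rewrite !inE !eqxx !orbT /=.
by move=> /esym/orP[] /eqP-> /esym/orP[] /eqP->; rewrite ?eqxx ?orbT ?orbb;
  [move=> _ /eqP ->|move=> _ _|move=> _ _|move=> /eqP -> _]; auto.
Qed.

Lemma next_last x s : uniq (x :: s) -> next (x :: s) (last x s) = x.
Proof.
move=> u; have := cycle_next u.
by rewrite /= rcons_path => /andP[_ /eqP].
Qed.

Lemma next_head x y s : uniq [:: x, y & s] -> next [:: x, y & s] x = y.
Proof. by move=> u; have := cycle_next u; rewrite /= => /andP[/eqP]. Qed.

Lemma cycle_edges_rot n s : uniq s -> cycle_edges (rot n s) = cycle_edges s.
Proof.
move=> u; rewrite /cycle_edges; apply/setP => A.
apply/imsetP/imsetP => -[x xs ->]; exists x; rewrite ?next_rot //.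
  by rewrite mem_rot in xs.
by rewrite mem_rot.
Qed.

(** Used to conclude that cycles with equal edge sets have equal vertex sets. *)
Lemma cycle_edges_cover s : [set x in s] = cover (cycle_edges s).
Proof.
apply/setP => x; rewrite inE; apply/idP/bigcupP => [xs|[A /imsetP[y ys ->]]].
  by exists [set x; next s x]; rewrite ?setU11 //; apply/imsetP; exists x.
by rewrite !inE => /orP[] /eqP ->; rewrite ?mem_next.
Qed.

(** A simple path from [x] to [y] avoiding the edge closes up with it to a cycle. The path has an
    inner vertex, since a single step would be the deleted edge; hence more than two vertices in
    all. *)
Lemma cycle_of_edge x y : symmetric e -> irreflexive e -> e x y ->
    connect (off [set [set x; y]]) x y ->
  exists2 s, is_cycle e s & [set x; y] \in cycle_edges s.
Proof.
move=> esym eirr exy /connectP[p0 /shortenP[p xp u _] yE {p0}].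
exists (x :: p).
  rewrite /is_cycle /ucycleb u andbT /= rcons_path -yE esym exy andbT.
  rewrite (sub_path _ xp) /= => [|a b /andP[] //].
  case: p xp yE {u} => [_ yE|a [|b p] //=]; first by rewrite yE /= eirr in exy.
  by rewrite /off /= inE => /andP[/andP[_ nE] _] yE; rewrite yE eqxx in nE.
apply/imsetP; exists y; first by rewrite yE mem_last.
by rewrite {3}yE next_last // setUC.
Qed.

(** Otherwise a detour off the edges of the cycle joins two of its vertices. Replacing an arc by the
    detour gives a cycle with another edge set that shares both vertices, against the cactus
    condition. *)
Lemma off_cycle_connect s u w : cactus e -> is_cycle e s -> u \in s -> w \in s ->
  connect (off (cycle_edges s)) u w -> u = w.
Proof.
move=> [esym eirr _ _ share] cs us ws uw; apply/eqP; apply: contraT => neq.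
have su : uniq s by case/andP: cs => /andP[].
case: (rot_to us) => i s' rotE.
have [mE cE] : s =i u :: s' /\ cycle_edges s = cycle_edges (u :: s').
  by rewrite -rotE cycle_edges_rot //; split=> // x; rewrite mem_rot.
have cs' : is_cycle e (u :: s').
  by rewrite -rotE /is_cycle size_rot /ucycleb rot_cycle rot_uniq.
move: uw cs cs' ws share; rewrite cE mE.
move=> /connectP[p0 /shortenP[p pp up _] wE {p0}] _ cs' ws share.
(* [w'] is the first return of the path to the cycle, so the vertices of [p1] lie off it. *)
have /split_find pE : has (mem (u :: s')) p.
  apply/hasP; exists w => //; move: (mem_last u p); rewrite -wE inE eq_sym.
  by rewrite (negbTE neq).
move: pp up; case: pE => w' p1 p2 /= w's /hasPn p1s pp up.
have w'u : w' != u.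
  by apply: contraTneq up => ->; rewrite mem_cat mem_rcons mem_head.
have {}w's : w' \in s' by move: w's; rewrite inE (negbTE w'u).
(* The arc [q1] between [u] and [w'] will be replaced by [p1], and [q2] kept. *)
case/splitPr: w's cs' share pp p1s {mE cE rotE ws} => q1 q2 cs' share pp p1s.
have [up1 p1e lw] : [/\ u \notin p1, path (off (cycle_edges (u :: q1 ++ w' :: q2))) u p1
    & off (cycle_edges (u :: q1 ++ w' :: q2)) (last u p1) w'].
  move: pp up; rewrite cat_path rcons_path mem_cat mem_rcons inE.
  by case/andP=> /andP[-> ->] _ /andP[]; rewrite !negb_or => /andP[/andP[_ ->]].
have uq : uniq (u :: q1 ++ w' :: q2) by case/andP: cs' => /andP[].
have [uw uwq] : u \notin w' :: q2 /\ uniq (w' :: q2).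
  move: uq; rewrite cons_uniq mem_cat negb_or cat_uniq.
  by case/andP=> /andP[_ ->] /and3P[_ _ ->].
have ut : uniq (u :: p1 ++ w' :: q2).
  rewrite cons_uniq mem_cat negb_or up1 uw cat_uniq uwq andbT /=.
  move: up; rewrite /= cat_uniq rcons_uniq => /andP[_ /andP[/andP[_ ->] _]] /=.
  rewrite andbT -[_ || _]/(has (mem p1) (w' :: q2)).
  apply/hasPn => x xq; apply/negP => /p1s/negP[].
  by rewrite !inE mem_cat xq !orbT.
have ct : is_cycle e (u :: p1 ++ w' :: q2).
  rewrite /is_cycle /ucycleb ut andbT /= rcons_cat cat_path; apply/andP; split.
    rewrite (sub_path _ p1e) /= => [|a b /andP[] //].
    case/andP: lw => -> _ /=; case/andP: cs' => /andP[/= + _] _.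
    by rewrite rcons_cat cat_path /= => /and3P[].
  (* Only two vertices remain if [p1] and [q2] are both empty; but then the detour is the edge
     closing the original cycle from [w'] to [u]. *)
  rewrite size_cat /=; move: lw uq; clear; case: p1 q2 => [|? ?] [|? ?] //=; rewrite ?addnS //.
  move=> /andP[_ /negP nE] uq; case: nE; rewrite setUC; apply/imsetP; exists w'.
    by rewrite inE mem_cat mem_head !orbT.
  by have := next_last uq; rewrite last_cat /= => ->.
have : cycle_edges (u :: q1 ++ w' :: q2) != cycle_edges (u :: p1 ++ w' :: q2).
  (* The edge leaving [u] in the new cycle belongs to the detour, hence not to the old cycle. *)
  have [h hE hp] : exists2 h, next (u :: p1 ++ w' :: q2) u = h
      & off (cycle_edges (u :: q1 ++ w' :: q2)) u h.
    case: (p1) ut p1e lw => [|h p1'] ut'; first by exists w' => //; exact: next_head ut'.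
    by case/andP=> ? _ _; exists h => //; exact: next_head ut'.
  apply: contraL hp => /eqP ->; rewrite /off /= negb_and negbK; apply/orP; right.
  by apply/imsetP; exists u; rewrite ?mem_head // hE.
move=> /(share _ _ cs' ct); rewrite leqNgt => /negP[].
apply: (@leq_trans #|[set u; w']|); first by rewrite cards2 eq_sym w'u.
apply: subset_leq_card.
by apply/subsetP => x; rewrite !inE !mem_cat !inE => /orP[] /eqP ->; rewrite !eqxx ?orbT.
Qed.

End UndirectedCycles.

(** * Blocks of a directed cactus and their gates *)

Section Blocks.
Variables (R : realType) (G : network R).
Hypothesis Gcactus : directed_cactus G.
Local Notation U := (@underlying R G).
Implicit Types (C D : subgraph_data G) (x y u w : G).

Let oriented x y : edge x y -> ~~ edge y x.
Proof. by case: Gcactus => + _; apply. Qed.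

Let Ucactus : cactus U.
Proof. by case: Gcactus. Qed.

Let Usym : symmetric U.
Proof. by case: Ucactus. Qed.

Let Uirr : irreflexive U.
Proof. by case: Ucactus. Qed.

Definition block_edges C : {set {set G}} := [set [set a.1; a.2] | a in C.2].

Definition bridge_block x y : subgraph_data G := ([set x; y], [set (x, y)]).

Definition blocks : {set subgraph_data G} :=
  [set C | `[< C \in cycle_subgraphs G \/
               exists x y, bridge x y /\ C = bridge_block x y >]].

Lemma blocksP C : C \in blocks <->
  C \in cycle_subgraphs G \/ exists x y, bridge x y /\ C = bridge_block x y.
Proof. by rewrite inE; split=> /asboolP. Qed.

Lemma cycle_subgraphP C : C \in cycle_subgraphs G <-> is_cycle_subgraph C.
Proof. by rewrite inE; split=> /asboolP. Qed.

Lemma cycle_block C : C \in cycle_subgraphs G -> C \in blocks.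
Proof. by move=> CG; apply/blocksP; left. Qed.

Lemma block_edges_bridge x y : block_edges (bridge_block x y) = [set [set x; y]].
Proof. by rewrite /block_edges imset_set1. Qed.

Lemma block_sub C : C \in blocks -> is_subgraph C.
Proof.
case/blocksP => [/cycle_subgraphP[] //|[x [y [[xy _] ->]]]] a b.
by rewrite inE => /eqP[-> ->]; rewrite !inE !eqxx orbT.
Qed.

(** An edge of [G] has only one orientation, so its underlying pair decides whether it belongs to a
    block. *)
Lemma block_edgesP C x y : C \in blocks -> edge x y ->
  ([set x; y] \in block_edges C) = ((x, y) \in C.2).
Proof.
move=> CB exy; apply/idP/idP => [/imsetP[[a b] abC /= E]|xyC]; last first.
  by apply/imsetP; exists (x, y).
have [eab _ _] := block_sub CB abC.
case: (eq_set2 E) => -[-> ->] // in exy *.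
by move: (oriented exy); rewrite eab.
Qed.

Lemma block_vertices C x y : C \in blocks -> [set x; y] \in block_edges C ->
  x \in C.1 /\ y \in C.1.
Proof.
move=> CB /imsetP[[a b] abC /= E]; have [_ aC bC] := block_sub CB abC.
by case: (eq_set2 E) => -[-> ->].
Qed.

Lemma cycle_subgraph_edges C : C \in cycle_subgraphs G ->
  C.2 = [set a | edge a.1 a.2 && ([set a.1; a.2] \in block_edges C)].
Proof.
move=> /cycle_block CB; apply/setP => -[x y]; rewrite inE /=.
apply/idP/andP => [xyC|[exy]]; last by rewrite block_edgesP.
by have [exy _ _] := block_sub CB xyC; rewrite block_edgesP.
Qed.

Lemma cycle_subgraph_exists s : is_cycle U s ->
  exists2 C, C \in cycle_subgraphs G & block_edges C = cycle_edges s.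
Proof.
move=> cs; have us : uniq s by case/andP: cs => /andP[].
pose C : subgraph_data G := ([set x in s],
  [set a | edge a.1 a.2 && ([set a.1; a.2] \in cycle_edges s)]).
have CE : block_edges C = cycle_edges s.
  apply/setP => A; apply/imsetP/idP => [[a] + ->|].
    by rewrite inE => /andP[].
  move=> As; case/imsetP: (As) => x xs AE.
  have : underlying x (next s x) by apply: next_cycle xs; case/andP: cs => /andP[].
  rewrite /underlying /= => /orP[] exy; last rewrite setUC in AE.
    by exists (x, next s x); rewrite // inE exy -AE As.
  by exists (next s x, x); rewrite // inE exy -AE As.
exists C => //; apply/cycle_subgraphP; split=> [x y|].
  rewrite inE /= => /andP[exy xy]; split=> //; rewrite cycle_edges_cover;
  by apply/bigcupP; exists [set x; y]; rewrite // !inE eqxx ?orbT.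
by exists s.
Qed.

Lemma block_exists x y : edge x y -> exists2 C, C \in blocks & (x, y) \in C.2.
Proof.
move=> exy; have [[C CG xyC]|no] :=
    pselect (exists2 C, C \in cycle_subgraphs G & (x, y) \in C.2).
  by exists C => //; exact: cycle_block.
exists (bridge_block x y); last by rewrite inE.
apply/blocksP; right; exists x, y; split=> //; split=> // C CG.
by apply/negP => xyC; case: no; exists C.
Qed.

(** Two cycles with a common edge share its two ends, so the cactus condition makes their edge sets
    equal; a bridge lies in no cycle subgraph by definition. *)
Lemma block_unique C D x y : C \in blocks -> D \in blocks -> underlying x y ->
  [set x; y] \in block_edges C -> [set x; y] \in block_edges D -> C = D.
Proof.
have W (C0 D0 : subgraph_data G) x0 y0 : C0 \in blocks -> D0 \in blocks -> edge x0 y0 ->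
    [set x0; y0] \in block_edges C0 -> [set x0; y0] \in block_edges D0 -> C0 = D0.
  move=> CB DB exy; rewrite !block_edgesP // => xyC xyD.
  case/blocksP: (CB) => [CG|[a [b [ab CE]]]]; last first.
    move: xyC; rewrite CE inE => /eqP[xE yE]; case/blocksP: (DB) => [DG|[c [d [_ DE]]]].
      by case: ab => _ /(_ D0 DG); rewrite -xE -yE xyD.
    by move: xyD; rewrite DE inE => /eqP[<- <-]; rewrite xE yE.
  case/blocksP: (DB) => [DG|[a [b [[_ /(_ C0 CG) abC] DE]]]]; last first.
    by move: xyD; rewrite DE inE => /eqP[xE yE]; rewrite -xE -yE xyC in abC.
  have /cycle_subgraphP[_ [s [cs C1 C2]]] := CG.
  have /cycle_subgraphP[_ [t [ct D1 D2]]] := DG.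
  have st : cycle_edges s = cycle_edges t.
    apply/eqP; apply: contraT => st; case: Ucactus => _ _ _ _ /(_ s t cs ct st).
    have [_ xC yC] := block_sub CB xyC; have [_ xD yD] := block_sub DB xyD.
    rewrite -C1 -D1 leqNgt => /negP[]; apply: (@leq_trans #|[set x0; y0]|).
      by rewrite cards2; case/andP: exy => ->.
    by apply/subset_leq_card/subsetP => z; rewrite !inE => /orP[] /eqP ->;
      apply/andP.
  have E : block_edges C0 = block_edges D0 by rewrite /block_edges C2 D2.
  have F : C0.2 = D0.2 by rewrite !cycle_subgraph_edges // E.
  have K : C0.1 = D0.1 by rewrite C1 D1 !cycle_edges_cover st.
  by case: (C0) (D0) F K => [? ?] [? ?] /= -> ->.
move=> CB DB /orP[] exy; first exact: W exy.
by rewrite setUC; exact: W exy.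
Qed.

Definition avoid C : rel G := off U (block_edges C).

Lemma avoid_sym C : connect_sym (avoid C).
Proof. by apply: sym_connect_sym; exact: off_sym. Qed.

(** Uniqueness of gates. For a cycle this is [off_cycle_connect]; a connection around a bridge would
    close up to a cycle containing it. *)
Lemma avoid_connect_eq C u w : C \in blocks -> u \in C.1 -> w \in C.1 ->
  connect (avoid C) u w -> u = w.
Proof.
case/blocksP => [/cycle_subgraphP[_ [s [cs C1 C2]]]|[x [y [xyB ->]]]].
  rewrite C1 !inE => us ws; rewrite /avoid /block_edges C2.
  exact: off_cycle_connect ws.
have [exy no] := xyB.
have nc : ~~ connect (off U [set [set x; y]]) x y.
  apply/negP => xy; have [|s cs xys] := cycle_of_edge Usym Uirr _ xy.
    by rewrite /underlying /= exy.
  have [D DG DE] := cycle_subgraph_exists cs.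
  by move: (no D DG); rewrite -block_edgesP ?DE ?xys //; exact: cycle_block.
have Csym : connect_sym (off U [set [set x; y]]).
  by apply: sym_connect_sym; exact: off_sym.
rewrite /avoid block_edges_bridge /= !inE.
case/orP=> /eqP -> /orP[] /eqP -> //; first by rewrite (negbTE nc).
by rewrite Csym (negbTE nc).
Qed.

(** By [block_unique] no edge of [C] is one of [D], so going around [C] avoids [D]. Gates in [D] are
    therefore constant on [C]. *)
Lemma cycle_connect C D : C \in cycle_subgraphs G -> D \in blocks -> C != D ->
  {in C.1 &, forall x y, connect (avoid D) x y}.
Proof.
move=> CG DB CD; case/cycle_subgraphP: (CG) => _ [s [cs C1 C2]] x y.
rewrite C1 !inE; apply: connect_cycle.
have [cyc us] : cycle U s /\ uniq s by case/andP: cs => /andP[].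
apply: cycle_from_next => // z zs; have Uz := next_cycle cyc zs.
rewrite /avoid /off /= Uz /=; apply: contra CD => zD; apply/eqP.
apply: block_unique Uz _ zD => //; first exact: cycle_block.
by rewrite /block_edges C2; apply/imsetP; exists z.
Qed.

Lemma block_nonempty C : C \in blocks -> exists x, x \in C.1.
Proof.
case/blocksP => [/cycle_subgraphP[_ [[|x s] [/andP[_ //] _ -> _]]]|[x [y [_ ->]]]].
  by exists x; rewrite inE mem_head.
by exists x; rewrite !inE eqxx.
Qed.

(* The vertex of C through which every path from x to C enters C. *)
Definition gate C x : G := odflt x [pick u in C.1 | connect (avoid C) x u].

(** For existence, follow a path from [x] to a vertex of [C] and stop before its first edge in [C].
    So [gate] never takes its default value on a block. *)
Lemma gateP C x : C \in blocks -> gate C x \in C.1 /\ connect (avoid C) x (gate C x).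
Proof.
move=> CB; rewrite /gate; case: pickP => [u /andP[]|no] //=.
have [c cC] := block_nonempty CB.
suff [u uC xu] : exists2 u, u \in C.1 & connect (avoid C) x u.
  by have := no u; rewrite uC xu.
have : connect U x c by case: Ucactus.
case/connectP=> p + cE; elim: p x {no} cE => [|y p IH] x /= cE.
  by move=> _; exists x; rewrite ?connect0 // -cE.
case/andP=> xy /(IH _ cE)[u uC yu].
have [xyC|xyC] := boolP ([set x; y] \in block_edges C).
  by exists x; rewrite ?connect0 //; case: (block_vertices CB xyC).
by exists u => //; apply: connect_trans yu; apply: connect1; rewrite /avoid /off /= xy.
Qed.

Lemma gate_in C x : C \in blocks -> gate C x \in C.1.
Proof. by move=> CB; have [] := gateP x CB. Qed.

Lemma gate_id C x : C \in blocks -> x \in C.1 -> gate C x = x.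
Proof.
move=> CB xC; have [gC xg] := gateP x CB.
by apply/esym; exact: avoid_connect_eq xg.
Qed.

Lemma gate_connect C x y : C \in blocks -> connect (avoid C) x y ->
  gate C x = gate C y.
Proof.
move=> CB xy; have [gx xgx] := gateP x CB; have [gy ygy] := gateP y CB.
apply: (avoid_connect_eq CB gx gy); apply: connect_trans ygy.
by apply: connect_trans xy; rewrite avoid_sym.
Qed.

Lemma gate_edge C x y : C \in blocks -> underlying x y ->
  [set x; y] \notin block_edges C -> gate C x = gate C y.
Proof.
by move=> CB xy xyC; apply/gate_connect/connect1 => //; rewrite /avoid /off /= xy.
Qed.

End Blocks.

(** * Distances, gates and Dowker complexes *)

Section Distances.
Variables (R : realType) (G : network R).
Implicit Types (x y z : G) (p : seq G).

Lemma path_weight_cons x y p :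
  path_weight x (y :: p) = (weight x y + path_weight y p)%E.
Proof. by rewrite /path_weight /= big_cons. Qed.

Lemma path_weight_ge0 x p : (0 <= path_weight x p)%E.
Proof.
elim: p x => [|y p IH] x; first by rewrite /path_weight big_nil.
by rewrite path_weight_cons adde_ge0 // weight_ge0.
Qed.

Lemma dist_le_path x p : path (@edge R G) x p -> (dist x (last x p) <= path_weight x p)%E.
Proof. by move=> xp; apply: ereal_inf_lbound; exists p. Qed.

(** Truncating the path at [z] drops only nonnegative weights. *)
Lemma dist_on_path x p z : path (@edge R G) x p -> z \in x :: p ->
  (dist x z <= path_weight x p)%E.
Proof.
move=> + /splitPl zp; case: zp => p1 p2 <-; rewrite cat_path => /andP[xp1 _].
apply: le_trans (dist_le_path xp1) _.
by rewrite /path_weight pairmap_cat big_cat leeDl // path_weight_ge0.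
Qed.

Lemma le_dist (a : \bar R) x y :
  (forall p, path (@edge R G) x p -> last x p = y -> (a <= path_weight x p)%E) ->
  (a <= dist x y)%E.
Proof.
by move=> ap; apply: le_ereal_inf_tmp => _ [p [xp py ->]]; exact: ap.
Qed.

Lemma dist_refl x : (dist x x <= 0)%E.
Proof.
by have := @dist_le_path x [::] isT; rewrite /path_weight big_nil.
Qed.

Lemma dowkerP (delta : R) (s : {set G}) :
  reflect (s != set0 /\ exists y, forall x, x \in s -> (dist y x <= delta%:E)%E)
    (s \in dowker G delta).
Proof.
rewrite inE; apply: (iffP andP) => -[s0].
  by case/existsP => y /forall_inP ys; split=> //; exists y.
by case=> y ys; split=> //; apply/existsP; exists y; apply/forall_inP.
Qed.

End Distances.

Section CactusDistances.
Variables (R : realType) (G : network R) (delta : R).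
Hypothesis Gcactus : directed_cactus G.
Implicit Types (C : subgraph_data G) (x y z : G) (p : seq G).

(** The gate changes only along edges of [C], whose ends are their own gates. The first such edge of
    the path starts at the gate of [y]; the last one ends at the gate of the final vertex. *)
Lemma gate_on_path C y p : C \in blocks G -> path (@edge R G) y p ->
  gate C (last y p) != gate C y ->
  gate C (last y p) \in y :: p /\ gate C y \in y :: p.
Proof.
move=> CB; elim: p y => [|a p IH] y /=; first by rewrite eqxx.
case/andP=> ya /IH{}IH ne; have Uya : underlying y a by rewrite /underlying /= ya.
have [yaC|yaC] := boolP ([set y; a] \in block_edges C); last first.
  have ga := gate_edge Gcactus CB Uya yaC.
  by move: ne; rewrite ga => /IH[lP aP]; split; rewrite inE ?lP ?aP orbT.
have [yC aC] := block_vertices CB yaC.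
rewrite (gate_id Gcactus CB yC) mem_head; split=> //.
have [->|/IH[lP _]] := eqVneq (gate C (last a p)) (gate C a).
  by rewrite (gate_id Gcactus CB aC) !inE eqxx orbT.
by rewrite inE lP orbT.
Qed.

Lemma dist_gate C y x : C \in blocks G -> gate C x != gate C y ->
  (dist y (gate C x) <= dist y x)%E /\ (dist y (gate C y) <= dist y x)%E.
Proof.
move=> CB ne; split; apply: le_dist => p yp px; apply: dist_on_path => //;
  by have := @gate_on_path C y p CB yp; rewrite px => /(_ ne)[].
Qed.

Lemma dowker_gates C y x : C \in blocks G -> (dist y x <= delta%:E)%E ->
  gate C x != gate C y ->
  (dist y (gate C x) <= delta%:E)%E /\ (dist y (gate C y) <= delta%:E)%E.
Proof.
by move=> CB yx /(dist_gate CB)[xg yg]; split;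
  [apply: le_trans xg yx|apply: le_trans yg yx].
Qed.

Section Cycle.
Variables (C : subgraph_data G) (CG : C \in cycle_subgraphs G).

Definition sub_gate x : subnetwork C :=
  exist _ (gate C x) (gate_in Gcactus x (cycle_block CG)).

Definition sub_val (u : subnetwork C) : G := val u.

Lemma sub_gateK u : sub_gate (sub_val u) = u.
Proof.
by apply: val_inj; rewrite /= (gate_id Gcactus (cycle_block CG)) //; exact: (valP u).
Qed.

(** Edges of [C] are kept with their weights; every other edge collapses to a point, discarding a
    nonnegative weight. *)
Lemma sub_gate_path y p : path (@edge R G) y p -> exists q,
  [/\ path (@edge R (subnetwork C)) (sub_gate y) q, last (sub_gate y) q = sub_gate (last y p)
    & (path_weight (sub_gate y) q <= path_weight y p)%E].
Proof.
have CB := cycle_block CG.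
elim: p y => [|a p IH] y /=; first by exists [::]; rewrite /path_weight !big_nil.
case/andP=> ya /IH[q [aq qE qw]].
have Uya : underlying y a by rewrite /underlying /= ya.
have [yaC|yaC] := boolP ([set y; a] \in block_edges C); last first.
  have -> : sub_gate y = sub_gate a by apply: val_inj; exact: gate_edge.
  exists q; split=> //; rewrite path_weight_cons.
  by apply: le_trans qw _; rewrite leeDr // weight_ge0.
have [yC aC] := block_vertices CB yaC.
have [yE aE] := (gate_id Gcactus CB yC, gate_id Gcactus CB aC).
have wE : weight (sub_gate y) (sub_gate a) = weight y a.
  rewrite /weight /= /subgraph_weight /= yE aE.
  by rewrite -(block_edgesP Gcactus CB ya) yaC orbT.
exists (sub_gate a :: q); split => //=.
  rewrite aq andbT; apply/andP; split.
    by rewrite -(inj_eq val_inj) /= yE aE; case/andP: ya.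
  by rewrite wE; case/andP: ya.
by rewrite !path_weight_cons wE leeD2l.
Qed.

Lemma dist_sub_gate y x : (dist (sub_gate y) (sub_gate x) <= dist y x)%E.
Proof.
apply: le_dist => p /sub_gate_path[q [yq qE qw]] px.
by apply: le_trans qw; rewrite -px -qE; exact: dist_le_path.
Qed.

(** Distinct vertices have finite weight in the subnetwork only if the pair is in [C.2]. *)
Lemma edge_sub_val (u v : subnetwork C) : edge u v ->
  edge (sub_val u) (sub_val v) /\ weight (sub_val u) (sub_val v) = weight u v.
Proof.
rewrite /edge /= {1 2}/subgraph_weight => /andP[uv].
rewrite (negbTE uv) /=; case: ifP => // uvC w; split=> //.
by rewrite (inj_eq val_inj) uv.
Qed.

Lemma dist_sub_val (u v : subnetwork C) :
  (dist (sub_val u) (sub_val v) <= dist u v)%E.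
Proof.
apply: le_dist => p up <-.
suff [vp <-] : path (@edge R G) (sub_val u) (map sub_val p) /\
    path_weight (sub_val u) (map sub_val p) = path_weight u p.
  by rewrite -last_map; exact: dist_le_path.
elim: p u up => [|a p IH] u /=; first by rewrite /path_weight !big_nil.
case/andP=> /edge_sub_val[ua uw] /IH[ap apw].
by rewrite ua ap !path_weight_cons uw apw.
Qed.

Lemma dowker_sub_gate s : s \in dowker G delta ->
  [set sub_gate x | x in s] \in dowker (subnetwork C) delta.
Proof.
case/dowkerP => s0 [y ys]; apply/dowkerP; split.
  by case/set0Pn: s0 => x xs; apply/set0Pn; exists (sub_gate x); rewrite imset_f.
exists (sub_gate y) => _ /imsetP[x /ys yx ->].
exact: le_trans (dist_sub_gate _ _) yx.
Qed.

Lemma dowker_sub_val s : s \in dowker (subnetwork C) delta ->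
  [set sub_val x | x in s] \in dowker G delta.
Proof.
case/dowkerP => s0 [y ys]; apply/dowkerP; split.
  by case/set0Pn: s0 => x xs; apply/set0Pn; exists (sub_val x); rewrite imset_f.
exists (sub_val y) => _ /imsetP[x /ys yx ->].
exact: le_trans (dist_sub_val _ _) yx.
Qed.

End Cycle.
End CactusDistances.

(** * Splitting the homology *)

Section PushSmall.
Variable R : realType.
Implicit Types X Y : finType.

Lemma push_set0 X Y (f : X -> Y) :
  push f (simplex_chain R set0) = simplex_chain R set0.
Proof. by rewrite push_simplex enum_set0. Qed.

Lemma push_set1 X Y (f : X -> Y) x :
  push f (simplex_chain R [set x]) = simplex_chain R [set f x].
Proof. by rewrite push_simplex enum_set1 -seq_chain_enum enum_set1. Qed.

(** The simplices of [z] are nonempty, so those of its image contain [y] and [cone y] kills the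
    image. As the image is a cycle, [boundary_cone] makes it zero. *)
Lemma push_cst X Y (K : {set {set X}}) n (y : Y) (z : chain R X) :
  z \in cycles R K n -> push (fun=> y) z = 0.
Proof.
rewrite cyclesE => /andP[/chainsP zK /eqP z0].
have c0 : cone y (push (fun=> y) z) = 0.
  apply/ffunP => t; rewrite !ffunE; case: ifPn => // yt.
  have [->|/push_supp[s [/zK[_ sn] _ /setP/(_ y)]]] :=
    eqVneq (push (fun=> y) z (t :\ y)) 0; first by rewrite mulr0.
  have /card_gt0P[x xs] : (0 < #|s|)%N by rewrite sn.
  by rewrite !inE eqxx (imset_f (fun=> y) xs).
have := boundary_cone y (push (fun=> y) z).
by rewrite c0 -push_boundary z0 !linear0 addr0 => <-.
Qed.

End PushSmall.

Section Splitting.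
Variables (R : realType) (G : network R) (delta : R).
Hypothesis Gcactus : directed_cactus G.
Implicit Types (C : subgraph_data G) (x y : G) (s t : {set G}) (c z : chain R G).

Lemma underlying_block x y : underlying x y ->
  exists2 C, C \in blocks G & [set x; y] \in block_edges C.
Proof.
case/orP=> exy; have [C CB xyC] := block_exists exy; exists C => //.
  by rewrite block_edgesP.
by rewrite setUC block_edgesP.
Qed.

(** On a path from [x] to [y], each edge lies in exactly one block, where its ends are their own
    gates; in every other block its ends have equal gates. So each edge contributes the difference
    of its ends. *)
Lemma gate_telescope x y :
  \sum_(C in blocks G)
    (simplex_chain R [set gate C x] - simplex_chain R [set gate C y]) =
  simplex_chain R [set x] - simplex_chain R [set y].
Proof.
have : connect (@underlying R G) x y by case: Gcactus => _ [].
case/connectP=> p + ->; elim: p x => [|a p IH] x /=.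
  by move=> _; rewrite subrr big1 // => C _; rewrite subrr.
case/andP=> xa /IH{}IH; rewrite -[RHS](subrKA (simplex_chain R [set a])) -IH.
have [C CB xaC] := underlying_block xa.
rewrite (eq_bigr (fun C =>
  (simplex_chain R [set gate C x] - simplex_chain R [set gate C a])
  + (simplex_chain R [set gate C a] - simplex_chain R [set gate C (last a p)]))); last first.
  by move=> D _; rewrite subrKA.
rewrite big_split /=; congr (_ + _).
have [xC aC] := block_vertices CB xaC.
rewrite (bigD1 C) //= !(gate_id Gcactus CB) // big1 ?addr0 // => D /andP[DB DC].
rewrite (gate_edge Gcactus DB xa) ?subrr //; apply: contra DC => xaD.
by apply/eqP; exact: block_unique xa xaD xaC.
Qed.

Variable r : G.

Definition defect c : chain R G :=
  c - push (fun=> r) c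
    - \sum_(C in blocks G) (push (gate C) c - push (fun=> gate C r) c).

Fact defect_is_linear : linear defect.
Proof.
move=> a u v; rewrite /defect.
have -> : \sum_(C in blocks G) (push (gate C) (a *: u + v)
      - push (fun=> gate C r) (a *: u + v)) =
    a *: (\sum_(C in blocks G) (push (gate C) u - push (fun=> gate C r) u))
    + \sum_(C in blocks G) (push (gate C) v - push (fun=> gate C r) v).
  rewrite scaler_sumr -big_split; apply: eq_bigr => C _ /=.
  by rewrite 2!linearP scalerBr opprD addrACA.
by rewrite linearP !scalerBr !opprD /= [_ + v + _]addrACA [LHS]addrACA.
Qed.

HB.instance Definition _ :=
  GRing.isLinear.Build R (chain R G) (chain R G) _ defect defect_is_linear.

Lemma defect_boundary c : defect (boundary c) = boundary (defect c).
Proof.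
rewrite /defect [RHS]linearB [X in _ = X - _]linearB [X in _ = _ - X]linear_sum.
rewrite /= push_boundary; congr (_ - _).
by apply: eq_bigr => C _; rewrite linearB /= !push_boundary.
Qed.

Lemma defect_set0 : defect (simplex_chain R set0) = 0.
Proof.
rewrite /defect push_set0 subrr sub0r big1 ?oppr0 // => C _.
by rewrite !push_set0 subrr.
Qed.

Lemma defect_set1 x : defect (simplex_chain R [set x]) = 0.
Proof.
rewrite /defect push_set1; apply/eqP; rewrite subr_eq0; apply/eqP.
by rewrite -gate_telescope; apply: eq_bigr => C _; rewrite !push_set1.
Qed.

Definition nonconstant C s := [exists x in s, exists y in s, gate C x != gate C y].

(** Blocks with a single gate on [s] are left out: that gate may be farther than [delta] from a
    centre of [s], and the gate map kills [s] once it has two vertices. *)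
Definition carrier s : {set G} :=
  s :|: \bigcup_(C in blocks G | nonconstant C s) [set gate C x | x in s].

Lemma carrier_homo : {homo carrier : s t / s \subset t}.
Proof.
move=> s t st; apply: setUSS => //; apply/bigcupsP => C /andP[CB nC].
apply: (subset_trans (imsetS _ st)); apply: bigcup_sup; rewrite CB /=.
case/exists_inP: nC => x xs /exists_inP[y ys xy].
by apply/exists_inP; exists x; rewrite ?(subsetP st) //;
  apply/exists_inP; exists y; rewrite ?(subsetP st).
Qed.

(* A path from y to x whose ends have distinct gates in C runs through both. *)
Lemma carrier_dowker s t : s \in dowker G delta -> t \subset carrier s ->
  t != set0 -> t \in dowker G delta.
Proof.
case/dowkerP => _ [y ys] tP t0; apply/dowkerP; split=> //; exists y => x xt.
have := subsetP tP x xt; rewrite inE => /orP[/ys //|/bigcupP[C /andP[CB nC]]].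
case/imsetP=> u us ->{x xt}; have [uy|uy] := eqVneq (gate C u) (gate C y); last first.
  by have [] := dowker_gates Gcactus CB (ys u us) uy.
(* The gate of [u] is now that of the centre [y]. A vertex [v] of [s] with another gate forces every
   path from [y] to [v] through it. *)
suff [v vs vy] : exists2 v, v \in s & gate C v != gate C y.
  by rewrite uy; have [] := dowker_gates Gcactus CB (ys v vs) vy.
case/exists_inP: nC => v vs /exists_inP[w ws vw].
have [vy|vy] := eqVneq (gate C v) (gate C y); last by exists v.
by exists w; rewrite // -vy eq_sym.
Qed.

(** With at most one vertex the defect is zero. With two or more, constant maps kill [s], and [t] is
    either [s] or its image under a gate map injective on [s], hence nonconstant. *)
Lemma defect_supp s t : defect (simplex_chain R s) t != 0 ->
  t \subset carrier s /\ #|t| = #|s|.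
Proof.
have [s1|] := leqP #|s| 1.
  suff -> : defect (simplex_chain R s) = 0 by rewrite ffunE eqxx.
  have [/eqP/cards1P[x ->]|s0] := eqVneq #|s| 1%N; first exact: defect_set1.
  rewrite (_ : s = set0) ?defect_set0 //; apply/eqP; rewrite -cards_eq0.
  by case: #|s| s1 s0 => [|[]].
move=> s_gt1 dt; have /card_gt1P[a [b [as_ bs ab]]] := s_gt1.
have cst (v : G) : push (fun=> v) (simplex_chain R s) t = 0.
  apply/eqP; apply: contraT => /push_simplex_supp[/(_ a b as_ bs erefl) E _].
  by rewrite E eqxx in ab.
have [ts|ts] := eqVneq t s; first by rewrite ts subsetUl.
suff [C CB /push_simplex_supp[injC ->]] : exists2 C, C \in blocks G &
    push (gate C) (simplex_chain R s) t != 0.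
  rewrite card_in_imset //; split=> //; apply: subset_trans (subsetUr _ _).
  apply: bigcup_sup; rewrite CB /=; apply/exists_inP; exists a => //.
  by apply/exists_inP; exists b => //; apply: contra ab => /eqP/injC ->.
apply: contrapT => no; case/eqP: dt.
rewrite /defect ffunE [X in _ + X]ffunE sum_ffunE big1.
  by rewrite 3!ffunE cst (negbTE ts) !subr0.
move=> C CB; rewrite 2!ffunE cst subr0.
have [//|Ct] := eqVneq (push (gate C) (simplex_chain R s) t) 0.
by case: no; exists C.
Qed.

Lemma cycle_split n z : z \in cycles R (dowker G delta) n ->
  z - \sum_(C in blocks G) push (gate C) z \in boundaries R (dowker G delta) n.
Proof.
move=> zK; have := carried_boundary (f := defect) defect_boundary defect_set0
  defect_supp (fun s => subsetUl s _) carrier_homo carrier_dowker zK.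
rewrite /= /defect (push_cst _ zK) subr0.
rewrite (eq_bigr (fun C => push (gate C) z)) // => C _.
by rewrite (push_cst (gate C r) zK) subr0.
Qed.

(** The image is filled by its cone from [x]. Only simplices avoiding [x] survive coning, and they
    lie in [[set y]]; so the cone is zero unless [n = 0], when it is a multiple of the edge, a
    simplex with centre [x]. *)
Lemma bridge_gate_boundary n x y z : (0 <= delta)%R ->
    bridge x y -> (n = 0%N -> (weight x y <= delta%:E)%E) ->
  z \in cycles R (dowker G delta) n ->
  push (gate (bridge_block x y)) z \in boundaries R (dowker G delta) n.
Proof.
move=> d0 xyB xy_le; rewrite cyclesE => /andP[/chainsP zK /eqP z0].
have CB : bridge_block x y \in blocks G.
  by apply/blocksP; right; exists x, y.
apply: (@cone_boundary _ _ _ _ x); first by rewrite -push_boundary z0 linear0.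
apply/chainsP => t; rewrite ffunE; case: ifPn => [xt|]; last by rewrite eqxx.
rewrite mulf_eq0 negb_or => /andP[_ /push_supp[s [/zK[sK sn] injC tE]]].
have tn : #|t :\ x| = n.+1 by rewrite tE card_in_imset.
have ty : t :\ x \subset [set y].
  apply/subsetP => u ut; have : u \in [set x; y].
    by move: ut; rewrite tE => /imsetP[v _ ->]; exact: (gate_in Gcactus v CB).
  by move: ut; rewrite !inE => /andP[/negbTE ->].
have n0 : n = 0%N.
  by have := subset_leq_card ty; rewrite tn cards1 ltnS leqn0 => /eqP.
rewrite (cardsD1 x) xt tn; split=> //; apply/dowkerP; split.
  by apply/set0Pn; exists x.
exists x => u ut; have [->|ux] := eqVneq u x.
  by apply: le_trans (dist_refl x) _; rewrite lee_fin.
have -> : u = y by apply/eqP; rewrite -in_set1 (subsetP ty) // !inE ux.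
have xy1 : path (@edge R G) x [:: y] by rewrite /= (proj1 xyB).
apply: le_trans (xy_le n0).
by have := dist_le_path xy1; rewrite path_weight_cons /path_weight big_nil adde0.
Qed.

End Splitting.

Theorem corollary22 (R : realType) (G : network R) (delta : R) (n : nat)
    (Gcactus : directed_cactus G) (delta_ge0 : (0 <= delta)%R)
    (bridge_le : n = 0%N ->
       forall x y : G, bridge x y -> (weight x y <= delta%:E)%E) :
  lmod_iso (reduced_homology R (dowker G delta) n)
    (dirsum (fun C : {C | C \in cycle_subgraphs G} =>
       reduced_homology R (dowker (subnetwork (val C)) delta) n)).
Proof.
have /card_gt0P[r _] : (0 < #|G|)%N by case: Gcactus => _ [].
pose gate_to (C : {C | C \in cycle_subgraphs G}) : G -> subnetwork (val C) :=
  sub_gate Gcactus (valP C).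
pose val_of (C : {C | C \in cycle_subgraphs G}) : subnetwork (val C) -> G :=
  @sub_val R G (val C).
apply: (@lmod_iso_quotv R (chain R G) _ _ _
  (fun C : {C | C \in cycle_subgraphs G} => chain R (subnetwork (val C))) _ _
  (fun C => push (gate_to C))).
- by move=> C z; apply: push_cycles => s; exact: dowker_sub_gate.
- by move=> C z; apply: push_boundaries => s; exact: dowker_sub_gate.
(* Injectivity: [z] is homologous to the sum of its gate images. Bridges contribute boundaries, and
   a gate map to a cycle factors through the subnetwork, where the image bounds by assumption. *)
- move=> z zK zB; rewrite -[z](subrK (\sum_(C in blocks G) push (gate C) z)).
  apply: rpredD; first exact: (cycle_split Gcactus r).
  apply: rpred_sum => C /blocksP[CG|[x [y [xyB ->]]]]; last first.
    by apply: bridge_gate_boundary => // /bridge_le; exact.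
  have -> : push (gate C) z =
      push (val_of (exist _ C CG)) (push (gate_to (exist _ C CG)) z).
    by rewrite push_comp; exact: eq_push.
  by apply: push_boundaries (zB _) => s; exact: dowker_sub_val.
(* Surjectivity: the preimage is the sum of the included cycles. *)
move=> w wK; exists (\sum_C push (val_of C) (w C)).
  apply: rpred_sum => C _; apply: push_cycles (wK C) => s; exact: dowker_sub_val.
move=> D; rewrite linear_sum (bigD1 D) //= push_comp.
rewrite (eq_push (g := id)) => [|u]; last exact: sub_gateK.
(* On a cycle [C] other than [D] the gate in [D] is constant, equal to that of any vertex [c] of
   [C], so [push_cst] kills the term. *)
rewrite push_id big1 ?addr0 ?subrr ?mem0v // => C CD.
have [c cC] := block_nonempty (cycle_block (valP C)).
rewrite push_comp -(push_cst (gate_to D c) (wK C)).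
apply: eq_push => u; apply: val_inj => /=.
apply: (gate_connect Gcactus (cycle_block (valP D))).
apply: (cycle_connect Gcactus (valP C) (cycle_block (valP D))) => //.
exact: valP u.
Qed.
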